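(* For every integer $n\ge 0$, partitions of the set $[n]=\{1,2,\ldots,n\}$ are in one-to-one correspondence with the permutations in $\mathcal{S}_n$ that avoid the pattern $(a\text{-}cb)$. Hence $|\mathcal{S}_n(a\text{-}cb)|=B_n$, where $B_n$ is the $n$th Bell number, i.e. the number of partitions of $[n]$.
   Context: $\mathcal{S}_n$ is the set of permutations of $[n]$, written as words $\pi=a_1a_2\cdots a_n$ (with $\mathcal{S}_0$ consisting of the empty word only). A (generalised) pattern is a word in distinct letters of the ordered alphabet $a<b<c<\cdots$ in which two adjacent letters may or may not be separated by a dash. A $p$-subword of $\pi$ is a subword $a_{i_1}a_{i_2}\cdots a_{i_k}$ ($i_1<i_2<\cdots<i_k$) whose letters are in the same relative order as the letters of $p$, and such that $i_{j+1}=i_j+1$ whenever the $j$th and $(j+1)$st letters of $p$ are not separated by a dash. For example, an $(a\text{-}cb)$-subword of $\pi$ is a subword $a_ia_ja_{j+1}$ with $i<j$ and $a_i<a_{j+1}<a_j$. A permutation avoids $p$ if it has no $p$-subword; $\mathcal{S}_n(p)$ is the set of permutations in $\mathcal{S}_n$ avoiding $p$. A partition of a set is a family of pairwise disjoint non-empty subsets (blocks) whose union is the set. *)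

(* Defs.v *)
From mathcomp Require Import all_boot perm.

Set Implicit Arguments.
Unset Strict Implicit.
Unset Printing Implicit Defensive.

(* The set [n] = {1, ..., n} is rendered by 'I_n
   (values 0, ..., n - 1), and a permutation a_1 a_2 ... a_n by the s : 'S_n
   such that s i is the letter at position i, so that a_(i+1) = (s i).+1. *)

(* The letters a < b < c < ... are coded by 0 < 1 < 2 < ...; the Boolean
   nth false (dashes p) j, for j.+1 < size (letters p), says whether the letters
   of (0-based) indices j and j.+1 are separated by a dash. *)
Record pattern := Pattern {
  letters : seq nat;
  dashes : seq bool;
  letters_uniq : uniq letters;
  size_dashes : size dashes == (size letters).-1
}.

Definition a_cb : pattern :=
  @Pattern [:: 0; 2; 1] [:: true; false] isT isT.

(* A subword of s is given by its sequence of positions i. *)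
Definition is_subword (p : pattern) (n : nat) (s : 'S_n)
    (i : {ffun 'I_(size (letters p)) -> 'I_n}) : bool :=
  let I := 'I_(size (letters p)) in
  [&& [forall j : I, forall k : I, (j < k) ==> (i j < i k)],
      [forall j : I, forall k : I,
         (s (i j) < s (i k)) == (nth 0 (letters p) j < nth 0 (letters p) k)]
    & [forall j : I, forall k : I,
         (k == j.+1 :> nat) && ~~ nth false (dashes p) j
           ==> (i k == (i j).+1 :> nat)]].

Arguments is_subword p {n} s i.

Definition avoids (p : pattern) (n : nat) (s : 'S_n) : bool :=
  ~~ [exists i, is_subword p s i].

Definition avoiders (n : nat) (p : pattern) : {set 'S_n} :=
  [set s : 'S_n | avoids p s].

Definition set_partitions (n : nat) : {set {set {set 'I_n}}} :=
  [set P : {set {set 'I_n}} | partition P [set: 'I_n]].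

Definition bell (n : nat) : nat := #|set_partitions n|.

(* Main.v *)
Require Import Defs.
From mathcomp Require Import all_boot perm.
From mathcomp Require Import zify.

(** Cut the word of a permutation just before each of its left-to-right minima.
    Avoiding a-cb means that the lower letter of every descent is smaller than
    all the letters before it, hence that every descent is followed by a new
    left-to-right minimum. So a permutation avoids a-cb exactly when all its
    factors are increasing; the first letter of a factor is then its minimum,
    and these minima decrease from left to right. The word can therefore be
    recovered from the mere set of its factors, and any set partition arises:
    write each block increasingly, and put the blocks in decreasing order of
    their minima.

    The two sides meet in the maps m sending an element to the minimum of its
    block, which are the idempotent maps with m x <= x ([min_map]). Such a map is
    determined by its fibres ([min_map_ext]), that is, by a partition. From a
    permutation, it is obtained as the least letter m x among those up to x
    ([prefix_min]), and the word then lists the elements in the order [block_lt]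
    attached to m: this is what avoidance amounts to ([avoids_block_lt]), and it
    determines the permutation. Conversely, listing the elements according to
    [block_lt] gives an avoider whose prefix minima are m ([word_avoids],
    [prefix_min_word]). *)

Section Avoiders.

Variable n : nat.
Implicit Types (x y z : 'I_n) (m : 'I_n -> 'I_n) (s : 'S_n).

(** * Avoidance in terms of three positions *)

Lemma avoids_acbP s :
  reflect (forall i j k : 'I_n, i < j -> k = j.+1 :> nat ->
             s i < s k -> s k < s j -> False)
          (avoids a_cb s).
Proof.
apply: (iffP idP) => [/existsPn avs i j k ij kj ik_lt kj_lt|avs].
- pose u : {ffun 'I_(size (letters a_cb)) -> 'I_n} :=
    [ffun l : 'I_3 => if val l is 0 then i else if val l is 1 then j else k].
  move/negP: (avs u); apply; apply/and3P; split.
  + apply/forallP => -[[|[|[|a]]] a3] //; apply/forallP => -[[|[|[|b]]] b3] //;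
      rewrite !ffunE /=; lia.
  + apply/forallP => -[[|[|[|a]]] a3] //; apply/forallP => -[[|[|[|b]]] b3] //;
      rewrite !ffunE /=; lia.
  + apply/forallP => -[[|[|[|a]]] a3] //; apply/forallP => -[[|[|[|b]]] b3] //;
      rewrite !ffunE /=; lia.
- apply/existsPn => u; apply/negP => /and3P[pos_lt ord_iso adj].
  pose l0 : 'I_(size (letters a_cb)) := @Ordinal 3 0 isT.
  pose l1 : 'I_(size (letters a_cb)) := @Ordinal 3 1 isT.
  pose l2 : 'I_(size (letters a_cb)) := @Ordinal 3 2 isT.
  apply: (avs (u l0) (u l1) (u l2)).
  + exact: (implyP (forallP (forallP pos_lt l0) l1)).
  + by apply/eqP; apply: (implyP (forallP (forallP adj l1) l2)).
  + by rewrite (eqP (forallP (forallP ord_iso l0) l2)).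
  + by rewrite (eqP (forallP (forallP ord_iso l2) l1)).
Qed.

(** * Maps to the minimum of a block *)

Definition min_map m := (forall x, m x <= x) /\ (forall x, m (m x) = m x).

(** As [x] and [m' x] lie in one fibre, [m x = m (m' x) <= m' x], and
    symmetrically. *)
Lemma min_map_ext m m' : min_map m -> min_map m' ->
  (forall x y, (m x == m y) = (m' x == m' y)) -> m =1 m'.
Proof.
move=> [m_le m_id] [m'_le m'_id] ker x; apply: val_inj; apply/eqP.
rewrite eqn_leq; apply/andP; split.
- have /eqP -> : m x == m (m' x) by rewrite ker m'_id.
  exact: m_le.
- have /eqP -> : m' x == m' (m x) by rewrite -ker m_id.
  exact: m'_le.
Qed.

(** The order of the letters in the word of the partition into fibres of [m]:
    blocks by decreasing minimum, and increasingly inside each block. *)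
Definition block_lt m x y := (m y < m x) || (m y == m x) && (x < y).

Lemma block_ltxx m x : block_lt m x x = false.
Proof. by rewrite /block_lt !ltnn andbF. Qed.

Lemma block_lt_trans m : transitive (block_lt m).
Proof. move=> y x z; rewrite /block_lt -!val_eqE /=; lia. Qed.

Lemma block_lt_total m x y : x != y -> block_lt m x y || block_lt m y x.
Proof. rewrite /block_lt -!val_eqE /=; lia. Qed.

(** * From avoiders to block minima *)

Definition prefix_min s x : 'I_n :=
  [arg min_(y < x | (s^-1)%g y <= (s^-1)%g x) val y].

Lemma prefix_minP s x :
  (s^-1)%g (prefix_min s x) <= (s^-1)%g x /\
  forall y, (s^-1)%g y <= (s^-1)%g x -> prefix_min s x <= y.
Proof. by rewrite /prefix_min; case: arg_minnP. Qed.

Lemma prefix_min_map s : min_map (prefix_min s).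
Proof.
split=> x; first by apply: (prefix_minP s x).2.
have [pos_x le_x] := prefix_minP s x.
have [pos_m le_m] := prefix_minP s (prefix_min s x).
apply: val_inj; apply/eqP; rewrite eqn_leq le_m //= le_x //.
exact: leq_trans pos_m pos_x.
Qed.

(** By induction on the second position: suppose that it holds the lower letter
    of a descent. The prefix minimum common to the two positions occurs at the
    first of them or earlier, hence is another, smaller letter, and forms an
    occurrence of a-cb with the descent. *)
Lemma avoids_increasing s (i j : 'I_n) : avoids a_cb s -> i < j ->
  prefix_min s (s i) = prefix_min s (s j) -> s i < s j.
Proof.
move=> /avoids_acbP avs; case: j => j.
elim: j => [//|k IHk] k1n; set j := Ordinal k1n => ij eq_ij.
have kn : k < n by apply: ltnW.
pose k' := Ordinal kn.
have [pos_i le_i] := prefix_minP s (s i).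
have [pos_k le_k] := prefix_minP s (s k').
have [pos_j le_j] := prefix_minP s (s j).
rewrite !permK /= in pos_i pos_k pos_j le_i le_k le_j.
have eq_ik : prefix_min s (s i) = prefix_min s (s k').
  apply: val_inj; apply/eqP; rewrite eqn_leq; apply/andP; split.
    by rewrite eq_ij; apply: le_j; apply: leq_trans pos_k _.
  by apply: le_k; apply: leq_trans pos_i _.
have le_ik : s i <= s k'.
  have [eqk|neqk] := eqVneq (i : nat) k; first by rewrite (_ : i = k') //;
    apply: val_inj.
  by apply: ltnW; apply: IHk => //=; move: ij neqk => /=; lia.
apply: leq_ltn_trans le_ik _; rewrite ltnNge; apply/negP => desc.
have neq_kj : s k' != s j :> nat.
  by apply/negP => /eqP/val_inj/perm_inj/(congr1 val) /=; lia.
set p := prefix_min s (s i) in pos_i eq_ij.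
have p_le : p <= s j by rewrite eq_ij; apply: le_j; rewrite permK.
have neq_pj : p != s j :> nat.
  apply/negP => /eqP/val_inj eq_pj.
  by move: pos_i ij; rewrite eq_pj permK /=; lia.
have neq_pk : (s^-1)%g p != k :> nat.
  apply/negP => /eqP eq_pk.
  have /(congr1 s) : (s^-1)%g p = k' by apply: val_inj.
  by rewrite permKV => eq_p; move: p_le neq_kj neq_pj; rewrite eq_p; lia.
apply: (avs ((s^-1)%g p) k' j) => //=.
- by move: pos_i ij neq_pk => /=; lia.
- by rewrite permKV; lia.
- by lia.
Qed.

Lemma avoids_block_lt s x y : avoids a_cb s ->
  ((s^-1)%g x < (s^-1)%g y) = block_lt (prefix_min s) x y.
Proof.
move=> avs.
have lt_block u v : (s^-1)%g u < (s^-1)%g v -> block_lt (prefix_min s) u v.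
  move=> uv; rewrite /block_lt.
  have [pos_u _] := prefix_minP s u.
  have [_ le_v] := prefix_minP s v.
  have := le_v _ (leq_trans pos_u (ltnW uv)).
  rewrite leq_eqVlt => /orP[/eqP/val_inj eq_uv|->//].
  rewrite eq_uv eqxx ltnn /=.
  have := @avoids_increasing s _ _ avs uv.
  by rewrite !permKV; apply.
apply/idP/idP => [|xy]; first exact: lt_block.
rewrite ltnNge leq_eqVlt; apply/negP => /orP[/eqP/val_inj/perm_inj eq_xy|/lt_block yx].
  by rewrite eq_xy block_ltxx in xy.
by have := block_lt_trans _ _ _ _ xy yx; rewrite block_ltxx.
Qed.

(** A position is the number of positions before it, so the order of the
    letters gives back the word. *)
Lemma perm_pos_inj (s t : 'S_n) :
  (forall x y, ((s^-1)%g x < (s^-1)%g y) = ((t^-1)%g x < (t^-1)%g y)) -> s = t.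
Proof.
have pos_card (u : 'S_n) y : #|[set x | (u^-1)%g x < (u^-1)%g y]| = (u^-1)%g y.
  rewrite -(card_imset _ (@perm_inj _ (u^-1)%g)).
  have -> : (u^-1)%g @: [set x | (u^-1)%g x < (u^-1)%g y] =
            [set i : 'I_n | i < (u^-1)%g y].
    apply/setP => i; rewrite inE; apply/imsetP/idP => [[x + ->]|lt_i].
      by rewrite inE.
    by exists (u i); rewrite ?inE permK.
  rewrite -sum1dep_card (big_ord_narrow (ltnW (ltn_ord _))) /=.
  by rewrite sum1_card card_ord.
move=> eq_lt; apply: invg_inj; apply/permP => y; apply: val_inj.
rewrite -[LHS]pos_card -[RHS]pos_card; congr #|pred_of_set _|.
by apply/setP => x; rewrite !inE eq_lt.
Qed.

(** * From block minima to avoiders *)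

Definition block_rank m x : nat := #|[set y | block_lt m y x]|.

Lemma block_rank_subproof m x : block_rank m x < n.
Proof.
rewrite -[X in _ < X]card_ord -cardsT; apply: proper_card.
by apply/properP; split; [exact: subsetT | exists x; rewrite !inE ?block_ltxx].
Qed.

Definition block_pos m x := Ordinal (block_rank_subproof m x).

Lemma block_pos_lt m x y : (block_pos m x < block_pos m y) = block_lt m x y.
Proof.
have mono u v : block_lt m u v -> block_rank m u < block_rank m v.
  move=> uv; apply: proper_card; apply/properP; split.
    by apply/subsetP => z; rewrite !inE => zu; apply: block_lt_trans _ _ _ _ zu uv.
  by exists u; rewrite !inE ?block_ltxx.
apply/idP/idP => [lt_xy|]; last exact: mono.
have [eq_xy|/(block_lt_total m)/orP[//|/mono]] := eqVneq x y.
  by rewrite eq_xy ltnn in lt_xy.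
by rewrite ltnNge ltnW.
Qed.

Lemma block_pos_inj m : injective (block_pos m).
Proof.
move=> x y eq_xy; apply/eqP; apply/negPn/negP => /(block_lt_total m).
by rewrite -!block_pos_lt eq_xy ltnn.
Qed.

Definition word m : 'S_n := (perm (@block_pos_inj m))^-1%g.

Lemma word_lt m x y : (((word m)^-1)%g x < ((word m)^-1)%g y) = block_lt m x y.
Proof. by rewrite invgK !permE block_pos_lt. Qed.

Lemma not_block_lt_min m x : min_map m -> ~~ block_lt m x (m x).
Proof.
by move=> [m_le m_id]; rewrite /block_lt m_id ltnn eqxx /= -leqNgt m_le.
Qed.

Lemma prefix_min_word m : min_map m -> prefix_min (word m) =1 m.
Proof.
move=> mm x; have [m_le m_id] := mm.
have [pos_x le_x] := prefix_minP (word m) x.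
apply: val_inj; apply/eqP; rewrite eqn_leq; apply/andP; split.
  by apply: le_x; rewrite leqNgt word_lt not_block_lt_min.
have : ~~ block_lt m x (prefix_min (word m) x) by rewrite -word_lt -leqNgt.
rewrite /block_lt negb_or -leqNgt => /andP[le_m _].
exact: leq_trans le_m (m_le _).
Qed.

(** In an occurrence of a-cb with letters [a], [c], [b], the descent from [c] to
    [b] leads to a block with a smaller minimum, namely [m b]; this minimum is
    not [b], because [m b < m c <= m a <= a < b]. So it would lie strictly
    before [b], yet after the adjacent letter [c]. *)
Lemma word_avoids m : min_map m -> avoids a_cb (word m).
Proof.
move=> mm; have [m_le m_id] := mm; apply/avoids_acbP => i j k ij kj.
set a := word m i; set b := word m k; set c := word m j => ab bc.
have ac : block_lt m a c by rewrite -word_lt !permK.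
have cb : block_lt m c b by rewrite -word_lt !permK kj.
have mbc : m b < m c.
  by move: cb; rewrite /block_lt [c < b]ltnNge (ltnW bc) andbF orbF.
have mca : m c <= m a.
  by move: ac; rewrite /block_lt => /orP[/ltnW//|/andP[/eqP->]].
have mb_b : block_lt m (m b) b.
  by rewrite /block_lt m_id ltnn eqxx /=; have := m_le a; lia.
have c_mb : block_lt m c (m b) by rewrite /block_lt m_id mbc.
by move: mb_b c_mb; rewrite -!word_lt !permK kj; lia.
Qed.

(** * Avoiders and set partitions *)

(** For an avoider, the blocks are the maximal increasing factors. *)
Definition runs s : {set {set 'I_n}} := preim_partition (prefix_min s) [set: 'I_n].

Lemma preim_partition_ker (T U V : finType) (f : T -> U) (g : T -> V) :
  preim_partition f [set: T] = preim_partition g [set: T] ->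
  forall x y : T, (f x == f y) = (g x == g y).
Proof.
move=> eq_fg x y.
have ker (W : finType) (h : T -> W) :
  (y \in pblock (preim_partition h [set: T]) x) = (h x == h y).
  apply: pblock_equivalence_partition; rewrite ?inE // => u v w _ _ _.
  by split=> // /eqP->.
by rewrite -!ker eq_fg.
Qed.

Lemma runs_inj : {in avoiders n a_cb &, injective runs}.
Proof.
move=> s t; rewrite !inE => avs avt eq_st; apply: perm_pos_inj => x y.
rewrite !avoids_block_lt // /block_lt.
have eq_min := min_map_ext _ _ (prefix_min_map s) (prefix_min_map t)
                 (preim_partition_ker _ _ _ _ _ eq_st).
by rewrite !eq_min.
Qed.

Definition block_min (P : {set {set 'I_n}}) x : 'I_n :=
  [arg min_(y < x | y \in pblock P x) val y].

Lemma block_minP P x : partition P [set: 'I_n] ->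
  block_min P x \in pblock P x /\
  forall y, y \in pblock P x -> block_min P x <= y.
Proof.
move=> partP; rewrite /block_min; case: arg_minnP => //.
by rewrite mem_pblock (cover_partition partP) inE.
Qed.

Lemma block_min_pblock P x : partition P [set: 'I_n] ->
  pblock P (block_min P x) = pblock P x.
Proof.
move=> partP; apply: same_pblock; first exact: partition_trivIset partP.
exact: (block_minP _ x partP).1.
Qed.

Lemma block_min_eq P x y : partition P [set: 'I_n] ->
  (block_min P x == block_min P y) = (pblock P x == pblock P y).
Proof.
move=> partP; apply/eqP/eqP => [eq_min|eq_pb].
  by rewrite -block_min_pblock // eq_min block_min_pblock.
have [in_x le_x] := block_minP _ x partP.
have [in_y le_y] := block_minP _ y partP.
apply: val_inj; apply/eqP.
by rewrite eqn_leq le_x ?eq_pb // le_y // -eq_pb.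
Qed.

Lemma block_min_map P : partition P [set: 'I_n] -> min_map (block_min P).
Proof.
move=> partP; split=> x.
  apply: (block_minP _ x partP).2.
  by rewrite mem_pblock (cover_partition partP) inE.
by apply/eqP; rewrite block_min_eq // block_min_pblock.
Qed.

Lemma runs_image : runs @: avoiders n a_cb = set_partitions n.
Proof.
apply/setP => P; rewrite inE; apply/imsetP/idP => [[s _ ->]|partP].
  exact: preim_partitionP.
have minP := block_min_map _ partP.
exists (word (block_min P)); first by rewrite inE word_avoids.
rewrite -[LHS](preim_partition_pblock partP).
rewrite /runs /preim_partition /equivalence_partition.
apply: eq_imset => x; apply/setP => y; rewrite !inE /=.
by rewrite !prefix_min_word // block_min_eq.
Qed.

End Avoiders.

Theorem proposition5 (n : nat) :
  (exists f : {P : {set {set 'I_n}} | P \in set_partitions n} ->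
              {s : 'S_n | s \in avoiders n a_cb},
     bijective f) /\
  #|avoiders n a_cb| = bell n.
Proof.
have card_eq : #|avoiders n a_cb| = bell n.
  by rewrite /bell -runs_image (card_in_imset (@runs_inj n)).
split=> //.
have runs_part s : s \in avoiders n a_cb -> runs n s \in set_partitions n.
  by move=> avs; rewrite -runs_image imset_f.
pose g (u : {s : 'S_n | s \in avoiders n a_cb}) :
    {P : {set {set 'I_n}} | P \in set_partitions n} :=
  exist _ (runs n (val u)) (runs_part _ (valP u)).
have g_inj : injective g.
  move=> u v /(congr1 val) /= eq_uv; apply: val_inj.
  exact: runs_inj (valP u) (valP v) eq_uv.
have [|f gK fK] := inj_card_bij g_inj; first by rewrite !card_sig card_eq.
by exists f; exists g.
Qed.
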